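(* Let $k$ be an algebraically closed field of arbitrary characteristic, $S=k[[\alpha_1,\dots,\alpha_n]]$ with maximal ideal $\mathfrak m$, and let $f\in P$. Then $$\mathfrak{aut}\cdot f=\operatorname{span}\langle x_i\cdot(\delta\lrcorner f)\mid \delta\in\mathfrak m,\ i=1,\dots,n\rangle,\qquad \mathfrak g f=Sf+\sum_{i=1}^n\mathfrak m\,(x_i\cdot f).$$ Moreover $$(\mathfrak g f)^\perp=\{\sigma\in S\mid \sigma\lrcorner f=0,\ \forall_i\ \deg(\sigma^{(i)}\lrcorner f)\le 0\}.$$ Suppose further that $f\in P$ is homogeneous of degree $d$. Then $(\mathfrak g f)^\perp$ is spanned by homogeneous operators (i.e. the homogeneous components of each of its elements belong to it), and $$(\mathfrak g f)^\perp_{\le d}=\{\sigma\in S_{\le d}\mid \sigma\lrcorner f=0,\ \forall_i\ \sigma^{(i)}\lrcorner f=0\}.$$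
   Context: $P$ is the space of $k$-linear functionals on $S$ vanishing on some power of $\mathfrak m$; pairing $\langle-,-\rangle:S\times P\to k$. It has a basis $\mathbf x^{[\mathbf a]}$ ($\mathbf a\in\mathbb N_0^n$, of degree $\sum a_i$) dual to the monomials $\alpha^{\mathbf a}$, $x_i$ is dual to $\alpha_i$, and $P$ is a divided power ring with $\mathbf x^{[\mathbf a]}\cdot\mathbf x^{[\mathbf b]}=\prod_i\binom{a_i+b_i}{a_i}\mathbf x^{[\mathbf a+\mathbf b]}$. $S$ acts on $P$ by contraction: $\langle\tau,\sigma\lrcorner f\rangle=\langle\tau\sigma,f\rangle$. For an ideal $J\subseteq S$ and $g\in P$, $Jg=\{\sigma\lrcorner g:\sigma\in J\}$. $\mathfrak{aut}$ is the space of $k$-linear derivations $D:S\to S$ with $D(\mathfrak m)\subseteq\mathfrak m$, and $\mathfrak g=\mathfrak{aut}+S$ inside the space of linear maps $S\to S$, where $\sigma\in S$ is viewed as multiplication by $\sigma$. An element $L\in\mathfrak g$ acts on $P$ by the dual map $L^\vee$, $\langle\tau,L^\vee(f)\rangle=\langle L(\tau),f\rangle$; thus $\mathfrak{aut}\cdot f=\{D^\vee(f):D\in\mathfrak{aut}\}$ and $\mathfrak g f=\{L^\vee(f):L\in\mathfrak g\}$. For a subspace $W\subseteq P$, $W^\perp=\{\sigma\in S:\langle\sigma,w\rangle=0\ \forall w\in W\}$. $\sigma^{(i)}$ denotes the $i$-th partial derivative of $\sigma\in S$. By convention $\deg(0)<0$. $S_{\le d}$ is the space of polynomials in the $\alpha_i$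 of degree at most $d$, and for a subspace $V\subseteq S$, $V_{\le d}=V\cap S_{\le d}$. *)

(* Defs.v *)
From HB Require Import structures.
From mathcomp Require Import all_boot all_order all_algebra.
From mathcomp Require Import mpoly.
From mathcomp Require Import boolp classical_sets functions cardinality fsbigop.

Set Implicit Arguments.
Unset Strict Implicit.
Unset Printing Implicit Defensive.

Import GRing.Theory.
Local Open Scope classical_set_scope.
Local Open Scope ring_scope.

(* S = k[[alpha_1, ..., alpha_n]]: [s a] is the coefficient of alpha^a. *)
Definition pseries (k : fieldType) (n : nat) : Type := 'X_{1..n} -> k.

Section PowerSeries.
Variables (k : fieldType) (n : nat).
Local Notation S := (pseries k n).

HB.instance Definition _ := GRing.Lmodule.copy S ('X_{1..n} -> k^o).

Definition ps_monom (a : 'X_{1..n}) : S := fun b => (b == a)%:R.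

Definition ps_one : S := ps_monom 0%MM.

(* The Cauchy product; the bounds on the indices only serve to make the sum
   finite. *)
Definition ps_mul (s t : S) : S := fun m =>
  \sum_(c : 'X_{1..n < (mdeg m).+1, (mdeg m).+1} | m == (c.1 + c.2)%MM)
     s c.1 * t c.2.

Definition ps_trunc N (s : S) : {mpoly k[n]} :=
  \sum_(a : 'X_{1..n < N}) s a *: 'X_[a].

Lemma ps_truncE N s a : (mdeg a < N)%N -> (ps_trunc N s)@_a = s a.
Proof.
move=> ltaN; rewrite /ps_trunc raddf_sum /= (bigD1 (BMultinom ltaN)) //=.
rewrite mcoeffZ mcoeffX eqxx mulr1 big1 ?addr0 // => b neb.
rewrite mcoeffZ mcoeffX; case: eqP => [eba|]; last by rewrite mulr0.
by case/eqP: neb; apply/val_inj.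
Qed.

Lemma ps_mulE N s t m : (mdeg m < N)%N ->
  ps_mul s t m = (ps_trunc N s * ps_trunc N t)@_m.
Proof.
move=> ltmN; rewrite mcoeffM; apply: eq_bigr => c _.
by rewrite !ps_truncE // (leq_trans _ ltmN) // bmdeg.
Qed.

Lemma ps_mul_trunc N s t p q m : (mdeg m < N)%N ->
  (forall a, (mdeg a < N)%N -> s a = p@_a) ->
  (forall a, (mdeg a < N)%N -> t a = q@_a) ->
  ps_mul s t m = (p * q)@_m.
Proof.
move=> ltmN sp tq; rewrite mcoeffM; apply: eq_bigr => c _.
by rewrite sp ?tq // (leq_trans _ ltmN) // bmdeg.
Qed.

Fact ps_mulA : associative ps_mul.
Proof.
move=> s t u; apply/funext => m; pose N := (mdeg m).+1.
pose T := ps_trunc N.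
rewrite (@ps_mul_trunc N _ _ (T s) (T t * T u)) //; last first.
- by move=> a ltaN; exact: ps_mulE.
- by move=> a ltaN; rewrite ps_truncE.
rewrite (@ps_mul_trunc N _ _ (T s * T t) (T u)) ?mulrA //.
- by move=> a ltaN; exact: ps_mulE.
- by move=> a ltaN; rewrite ps_truncE.
Qed.

Fact ps_mulC : commutative ps_mul.
Proof. by move=> s t; apply/funext => m; rewrite !(@ps_mulE (mdeg m).+1) // mulrC. Qed.

Fact ps_mul1 : left_id ps_one ps_mul.
Proof.
move=> s; apply/funext => m.
rewrite (@ps_mul_trunc (mdeg m).+1 _ _ 1 (ps_trunc (mdeg m).+1 s)) //.
- by rewrite mul1r ps_truncE.
- by move=> a _; rewrite mcoeff1.
- by move=> a lta; rewrite ps_truncE.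
Qed.

Fact ps_mulDl : left_distributive ps_mul +%R.
Proof.
move=> s t u; apply/funext => m.
rewrite /ps_mul [RHS]/GRing.add /= -big_split /=.
by apply: eq_bigr => c _; rewrite -mulrDl.
Qed.

Fact ps_oner_neq0 : ps_one != 0.
Proof.
apply/eqP => /(congr1 (fun s : S => s 0%MM)) /eqP.
by rewrite /ps_one /ps_monom eqxx (oner_eq0 k).
Qed.

HB.instance Definition _ := GRing.Zmodule_isComNzRing.Build S
  ps_mulA ps_mulC ps_mul1 ps_mulDl ps_oner_neq0.

Fact ps_scalerAl (c : k) (s t : S) : c *: (s * t) = c *: s * t.
Proof.
apply/funext => m; rewrite -[LHS]/(c * ps_mul s t m) -[RHS]/(ps_mul (c *: s) t m).
by rewrite mulr_sumr; apply: eq_bigr => i _; exact: mulrA.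
Qed.

HB.instance Definition _ := GRing.Lmodule_isLalgebra.Build k S ps_scalerAl.
HB.instance Definition _ := GRing.Lalgebra_isComAlgebra.Build k S.

Definition ps_max : set S := [set s | s 0%MM = 0].

(* The ideal generated by the N-fold products of elements of ps_max. *)
Definition ps_maxX (N : nat) : set S := [set s |
  exists (r : nat) (c : 'I_r -> S) (u : 'I_r -> 'I_N -> S),
    (forall j i, ps_max (u j i)) /\ s = \sum_j c j * \prod_i u j i].

Definition ps_deriv (i : 'I_n) (s : S) : S := fun a => s (a + U_(i))%MM *+ (a i).+1.

Definition ps_poly_le (d : nat) : set S :=
  [set s | forall a, (d < mdeg a)%N -> s a = 0].

Definition ps_homog_comp (j : nat) (s : S) : S :=
  fun a => if mdeg a == j then s a else 0.

(* aut and g, inside the space of k-linear maps S -> S. *)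
Definition aut : set {linear S -> S} := [set D |
  (forall s t, D (s * t) = D s * t + s * D t) /\
  (forall s, ps_max s -> ps_max (D s))].

Definition aut_add_S : set {linear S -> S} := [set L |
  exists D : {linear S -> S}, aut D /\ exists s, forall t, L t = D t + s * t].

End PowerSeries.

Arguments ps_max {k n}.
Arguments ps_poly_le {k n}.
Arguments aut {k n}.
Arguments aut_add_S {k n}.

Section LowOrder.
Variables (k : fieldType) (n : nat).
Local Notation S := (pseries k n).

Lemma ps_addE (s t : S) a : (s + t) a = s a + t a. Proof. by []. Qed.
Lemma ps_scaleE c (s : S) a : (c *: s) a = c * s a. Proof. by []. Qed.
Lemma ps_sumE I (r : seq I) (F : I -> S) a : (\sum_(i <- r) F i) a = \sum_(i <- r) F i a.
Proof. by elim/big_rec2: _ => // i x y _ <-. Qed.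

Lemma ps_mul_coef (s t : S) m : (s * t) m =
  \sum_(c : 'X_{1..n < (mdeg m).+1, (mdeg m).+1} | m == (c.1 + c.2)%MM)
     s c.1 * t c.2.
Proof. by []. Qed.

Lemma ps_mul_low M N (s t : S) :
  (forall a, (mdeg a < M)%N -> s a = 0) -> (forall a, (mdeg a < N)%N -> t a = 0) ->
  forall a, (mdeg a < M + N)%N -> (s * t) a = 0.
Proof.
move=> s0 t0 a lta; rewrite ps_mul_coef big1 // => c /eqP ea.
have [ltM|leM] := ltnP (mdeg c.1) M; first by rewrite s0 ?mul0r.
rewrite t0 ?mulr0 // -(ltn_add2l (mdeg c.1)) -mdegD -ea.
by rewrite (leq_trans lta) // leq_add2r.
Qed.

Lemma ps_max_low (s : S) : ps_max s -> forall a, (mdeg a < 1)%N -> s a = 0.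
Proof. by move=> s0 a; rewrite ltnS leqn0 mdeg_eq0 => /eqP ->. Qed.

Lemma ps_maxX_low N (s : S) : ps_maxX N s -> forall a, (mdeg a < N)%N -> s a = 0.
Proof.
move=> [r [c [u [mu ->]]]] a lta; rewrite ps_sumE big1 // => j _.
rewrite -[N]add0n in lta; apply: ps_mul_low lta => //.
elim: N u mu => [|N IH] u mu // b.
rewrite big_ord_recl => ltb; apply: (@ps_mul_low 1 N) ltb.
  exact: ps_max_low.
exact: (IH (fun j i => u j (lift ord0 i))).
Qed.

Lemma ps_maxX_mul N (s t : S) : ps_maxX N s -> ps_maxX N (t * s).
Proof.
move=> [r [c [u [mu ->]]]]; exists r, (fun j => t * c j), u; split => //.
by rewrite mulr_sumr; apply: eq_bigr => j _; rewrite mulrA.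
Qed.

Lemma ps_maxX_add N (s t : S) : ps_maxX N s -> ps_maxX N t -> ps_maxX N (s + t).
Proof.
move=> [r [c [u [mu ->]]]] [r' [c' [u' [mu' ->]]]].
exists (r + r')%N, (fun j => match fintype.split j with inl x => c x | inr x => c' x end),
  (fun j => match fintype.split j with inl x => u x | inr x => u' x end); split.
  by move=> j i; case: fintype.splitP.
rewrite big_split_ord /=; congr (_ + _); apply: eq_bigr => j _.
  by rewrite (unsplitK (inl _ j)).
by rewrite (unsplitK (inr _ j)).
Qed.

Lemma ps_maxX0 N : ps_maxX N (0 : S).
Proof.
exists 0%N, (fun _ => 0), (fun _ _ => 0); split; first by case.
by rewrite big_ord0.
Qed.

Lemma ps_maxX_le M N (s : S) : (M <= N)%N -> ps_maxX N s -> ps_maxX M s.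
Proof.
move=> /subnKC <-; move: (N - M)%N => {}N [r [c [u [mu ->]]]].
exists r, (fun j => c j * \prod_(i < N) u j (rshift M i)), (fun j i => u j (lshift N i)).
split=> // ; apply: eq_bigr => j _.
by rewrite big_split_ord /= -mulrA; congr (_ * _); rewrite mulrC.
Qed.

Lemma aut_maxX (D : {linear S -> S}) N s : aut D -> ps_maxX N s -> ps_maxX N (D s).
Proof.
move=> [Dmul Dmax] [r [c [u [mu ->]]]]; rewrite linear_sum.
elim/big_ind: _ => [||j _]; [exact: ps_maxX0 | exact: ps_maxX_add |].
have prodX (v : 'I_N -> S) : (forall i, ps_max (v i)) -> ps_maxX N (\prod_i v i).
  move=> mv; exists 1%N, (fun _ => 1), (fun _ => v); split => //.
  by rewrite big_ord1 mul1r.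
rewrite Dmul; apply: ps_maxX_add; first exact/ps_maxX_mul/prodX.
apply: ps_maxX_mul; have {}mu := mu j; move: (u j) mu => {}u mu {prodX}.
elim: N u mu => [|N IH] u mu.
  exists 1%N, (fun _ => D (\prod_i u i)), (fun _ => u); split => //.
  by rewrite big_ord1 [in X in _ = _ * X]big_ord0 mulr1.
rewrite big_ord_recl Dmul; apply: ps_maxX_add.
  exists 1%N, (fun _ => 1), (fun _ i => if unlift ord0 i is Some i' then u i else D (u i)).
  split=> [_ i|]; first by case: unliftP => // *; exact: Dmax.
  rewrite big_ord1 mul1r big_ord_recl unlift_none; congr (_ * _).
  by apply: eq_bigr => i _; rewrite liftK.
have [r' [c' [u' [mu' ->]]]] := IH _ (fun i => mu (lift ord0 i)).
exists r', c', (fun j i => if unlift ord0 i is Some i' then u' j i' else u ord0).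
split=> [j' i|]; first by case: unliftP.
rewrite mulr_sumr; apply: eq_bigr => j' _.
rewrite big_ord_recl unlift_none mulrCA; congr (_ * (_ * _)).
by apply: eq_bigr => i _; rewrite liftK.
Qed.

Lemma ps_monomM (a b : 'X_{1..n}) :
  ps_monom k a * ps_monom k b = ps_monom k (a + b)%MM :> S.
Proof.
apply/funext => m; rewrite -[LHS]/(ps_mul (ps_monom k a) (ps_monom k b) m).
rewrite (@ps_mul_trunc _ _ (mdeg m).+1 _ _ 'X_[a] 'X_[b]) //.
- by rewrite -mpolyXD mcoeffX eq_sym.
- by move=> c _; rewrite mcoeffX eq_sym.
- by move=> c _; rewrite mcoeffX eq_sym.
Qed.

Lemma ps_maxXS N (s t : S) : ps_max s -> ps_maxX N t -> ps_maxX N.+1 (s * t).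
Proof.
move=> ms [r [c [u [mu ->]]]].
exists r, c, (fun j i => if unlift ord0 i is Some i' then u j i' else s).
split=> [j i|]; first by case: unliftP.
rewrite mulr_sumr; apply: eq_bigr => j _.
rewrite big_ord_recl unlift_none mulrCA; congr (_ * (_ * _)).
by apply: eq_bigr => i _; rewrite liftK.
Qed.

Lemma ps_maxX_monom (a : 'X_{1..n}) : ps_maxX (mdeg a) (ps_monom k a).
Proof.
have [N eN] : exists N, mdeg a = N by exists (mdeg a).
rewrite eN; elim: N => [|N IH] in a eN *.
  exists 1%N, (fun _ => ps_monom k a), (fun _ _ => 0); split; first by move=> _ [].
  by rewrite big_ord1 big_ord0 mulr1.
have [i ai_gt0] : exists i, (0 < a i)%N.
  apply/existsP; apply: contra_eqT eN => /existsPn a0.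
  rewrite mdegE big1 // => i _; apply/eqP; rewrite -leqn0 leqNgt; exact: a0.
have ea : a = (U_(i) + (a - U_(i)))%MM by rewrite addmC submK // lep1mP -lt0n.
rewrite ea -ps_monomM; apply: ps_maxXS.
  by rewrite /ps_max /= /ps_monom eq_sym -mdeg_eq0 mdeg1.
by apply: IH; apply/eqP; rewrite -eqSS -eN [in X in _ == X]ea mdegD mdeg1.
Qed.

End LowOrder.

(* P: the k-linear functionals on S vanishing on some power of ps_max. *)
Definition dpP (k : fieldType) (n : nat) : {pred pseries k n -> k^o} :=
  fun phi => `[< scalar phi /\ exists N, forall s, ps_maxX N s -> phi s = 0 >].

Section DividedPowers.
Variables (k : fieldType) (n : nat).
Local Notation S := (pseries k n).

Record dpring := DPRing { pairing_fun : S -> k^o; _ : pairing_fun \in @dpP k n }.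
HB.instance Definition _ := [isSub for pairing_fun].
HB.instance Definition _ := [Choice of dpring by <:].

Fact dpP_submod_closed : submod_closed (@dpP k n).
Proof.
split=> [|c f g /asboolP[fl [M fM]] /asboolP[gl [N gN]]]; apply/asboolP.
  split=> [c s t|]; first by rewrite mulr0 addr0.
  by exists 0%N.
split=> [b s t|].
  rewrite -[LHS]/(c * f (b *: s + t) + g (b *: s + t)) fl gl.
  rewrite -[RHS]/(b * (c * f s + g s) + (c * f t + g t)).
  by rewrite !mulrDr addrACA !mulrA (mulrC b c).
exists (maxn M N) => s sMN; rewrite -[LHS]/(c * f s + g s) fM ?gN ?mulr0 ?addr0 //.
  exact: ps_maxX_le (leq_maxr _ _) sMN.
exact: ps_maxX_le (leq_maxl _ _) sMN.
Qed.
HB.instance Definition _ := GRing.isSubmodClosed.Build k (S -> k^o) (@dpP k n)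
  dpP_submod_closed.
HB.instance Definition _ := [SubChoice_isSubLmodule of dpring by <:].

Definition pairing (s : S) (f : dpring) : k := pairing_fun f s.

Fact contr_subproof (s : S) (f : dpring) :
  (fun t => pairing (t * s) f) \in @dpP k n.
Proof.
case: f => f /[dup] /asboolP[fl [N fN]] fP; apply/asboolP; split=> [c t u|].
  by rewrite /pairing /= mulrDl -scalerAl fl.
by exists N => t tN; rewrite /pairing /= mulrC fN //; exact: ps_maxX_mul.
Qed.
Definition contr (s : S) (f : dpring) : dpring := DPRing (contr_subproof s f).

Fact dual_act_subproof (L : {linear S -> S}) (gL : aut_add_S L) (f : dpring) :
  (fun t => pairing (L t) f) \in @dpP k n.
Proof.
case: f => f /[dup] /asboolP[fl [N fN]] fP; apply/asboolP; split=> [c t u|].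
  by rewrite /pairing /= linearP fl.
case: gL => D [aD [s Ls]]; exists N => t tN; rewrite /pairing /= Ls fN //.
by apply: ps_maxX_add; [exact: aut_maxX | exact: ps_maxX_mul].
Qed.
Definition dual_act (L : {linear S -> S}) (gL : aut_add_S L) (f : dpring) : dpring :=
  DPRing (dual_act_subproof gL f).

Fact aut_sub (D : {linear S -> S}) : aut D -> aut_add_S D.
Proof. by move=> aD; exists D; split=> //; exists 0 => t; rewrite mul0r addr0. Qed.

Definition aut_orbit (f : dpring) : set dpring :=
  [set h | exists (D : {linear S -> S}) (aD : aut D), h = dual_act (aut_sub aD) f].

Definition g_orbit (f : dpring) : set dpring :=
  [set h | exists (L : {linear S -> S}) (gL : aut_add_S L), h = dual_act gL f].

(* The basis x^[a] of P dual to the monomials alpha^a. *)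
Fact dpX_subproof (a : 'X_{1..n}) : (fun s : S => s a) \in @dpP k n.
Proof.
apply/asboolP; split=> //; exists (mdeg a).+1 => s sN.
exact: ps_maxX_low sN _ _.
Qed.
Definition dpX (a : 'X_{1..n}) : dpring := DPRing (dpX_subproof a).

Definition dpcoef (f : dpring) (a : 'X_{1..n}) : k := pairing (ps_monom k a) f.

Lemma dpcoef_finite (f : dpring) : finite_set [set a | dpcoef f a != 0].
Proof.
case: f => f /[dup] /asboolP[_ [N fN]] fP.
apply: (@sub_finite_set _ _ (range (fun a : 'X_{1..n < N} => a : 'X_{1..n}))).
  move=> a; rewrite /dpcoef /pairing /= => fa; have [ltaN|leNa] := ltnP (mdeg a) N.
    by exists (BMultinom ltaN).
  by case/eqP: fa; apply: fN; apply: ps_maxX_le leNa (ps_maxX_monom k a).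
exact/finite_image/finite_finset.
Qed.

(* Bilinear extension of x^[a] x^[b] = \prod_i 'C(a_i + b_i, a_i) x^[a + b];
   the sum has finite support by [dpcoef_finite]. *)
Definition dpmul (f g : dpring) : dpring :=
  \sum_(ab \in [set: 'X_{1..n} * 'X_{1..n}])
    (dpcoef f ab.1 * dpcoef g ab.2
       * (\prod_i 'C(ab.1 i + ab.2 i, ab.1 i))%:R) *: dpX (ab.1 + ab.2)%MM.

(* The degree of a nonzero f is the largest degree of a basis element x^[a]
   occurring in f; the degree of 0 is set to -1. *)
Definition dpdeg (f : dpring) : int :=
  if f == 0 then -1
  else (\big[maxn/0%N]_(a \in [set a | dpcoef f a != 0]) mdeg a)%:Z.

Definition dphomog (d : nat) (f : dpring) : Prop :=
  forall a, mdeg a != d -> dpcoef f a = 0.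

Definition lspan (A : set dpring) : set dpring := [set h |
  exists (r : nat) (c : 'I_r -> k) (v : 'I_r -> dpring),
    (forall j, A (v j)) /\ h = \sum_j c j *: v j].

Definition ideal_act (J : set S) (g : dpring) : set dpring :=
  [set contr s g | s in J].

Definition subspace_add (A B : set dpring) : set dpring :=
  [set u + v | u in A & v in B].

Definition subspace_sum (A : 'I_n -> set dpring) : set dpring :=
  [set h | exists v : 'I_n -> dpring, (forall i, A i (v i)) /\ h = \sum_i v i].

Definition perp (A : set dpring) : set S :=
  [set s | forall h, A h -> pairing s h = 0].

End DividedPowers.

Arguments dpX {k n}.

(* Main.v *)
Require Import Defs.
From HB Require Import structures.
From mathcomp Require Import all_boot all_order all_algebra.
From mathcomp Require Import mpoly.
From mathcomp Require Import boolp classical_sets functions cardinality fsbigop.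

(* Multiplication by [x_i] on [P] is adjoint to the partial derivative [d_i] on
   [S], and every [D] in [aut] equals [\sum_i D(alpha_i) d_i].  So the action of
   [g] on [f] is computed by [sigma |-> \sum_i v_i d_i sigma + t sigma] with
   [v_i] in the maximal ideal and [t] arbitrary, and the Leibniz rule turns it
   into [S f + \sum_i m (x_i f)].  Testing [sigma] against these with [v_i] a
   nonconstant monomial gives the orthogonal; the degree 0 coefficient of
   [d_i sigma _| f] only sees the degree [d + 1] part of [sigma] when [f] is
   homogeneous of degree [d]. *)

Set Implicit Arguments.
Unset Strict Implicit.
Unset Printing Implicit Defensive.

Import GRing.Theory.
Local Open Scope classical_set_scope.
Local Open Scope ring_scope.

(** * Powers of the maximal ideal, read off coefficients *)

Section Series.
Variables (k : fieldType) (n : nat).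
Local Notation S := (pseries k n).
Implicit Types (s t : S) (a b : 'X_{1..n}).

Lemma ps_monomE a b : ps_monom k a b = (b == a)%:R.
Proof. by []. Qed.

Lemma ps_max_monom a : a != 0%MM -> ps_max (ps_monom k a).
Proof. by move=> a0; rewrite /ps_max /= ps_monomE eq_sym (negbTE a0). Qed.

Lemma ps_max_var (i : 'I_n) : ps_max (ps_monom k U_(i)%MM).
Proof. by apply: ps_max_monom; rewrite mnm1_eq0. Qed.

(** Used contrapositively: it reduces the vanishing of a coefficient of a product to the supports of
    the factors, away from the bounded Cauchy sum. *)
Lemma ps_mul_coef_neq0 s t m : (s * t) m <> 0 ->
  exists a b, [/\ m = (a + b)%MM, s a <> 0 & t b <> 0].
Proof.
apply: contra_notP => nex; rewrite ps_mul_coef big1 // => c /eqP mE.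
have [->|/eqP s0] := eqVneq (s c.1) 0; first by rewrite mul0r.
have [->|/eqP t0] := eqVneq (t c.2) 0; first by rewrite mulr0.
by case: nex; exists c.1, c.2.
Qed.

Lemma ps_mul_coef0 s t : (s * t) 0%MM = s 0%MM * t 0%MM.
Proof.
rewrite -[LHS]/(ps_mul s t 0%MM).
rewrite (@ps_mul_trunc _ _ 1 _ _ (s 0%MM)%:MP (t 0%MM)%:MP) ?mdeg0 //.
- by rewrite -mpolyCM mcoeffC eqxx mulr1.
- by move=> a; rewrite ltnS leqn0 mdeg_eq0 => /eqP ->; rewrite mcoeffC eqxx mulr1.
- by move=> a; rewrite ltnS leqn0 mdeg_eq0 => /eqP ->; rewrite mcoeffC eqxx mulr1.
Qed.

Lemma ps_mul_monom a s b : (ps_monom k a * s) (a + b)%MM = s b.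
Proof.
rewrite ps_mul_coef.
have la : (mdeg a < (mdeg (a + b)%MM).+1)%N by rewrite mdegD ltnS leq_addr.
have lb : (mdeg b < (mdeg (a + b)%MM).+1)%N by rewrite mdegD ltnS leq_addl.
rewrite (bigD1 (BMultinom la, BMultinom lb)) //= ps_monomE eqxx mul1r.
rewrite big1 ?addr0 // => -[c e] /= /andP[/eqP abE ce].
rewrite ps_monomE; case: eqP => [ca|]; last by rewrite mul0r.
case/eqP: ce; congr pair; apply/val_inj => //=.
by apply: (@addmI _ a); exact: etrans (congr1 (mnm_add^~ e) (esym ca)) (esym abE).
Qed.

Lemma mnm_subUK a i : a i != 0%N -> (U_(i) + (a - U_(i)))%MM = a.
Proof. by move=> ai; rewrite addmC submK // lep1mP. Qed.

Lemma ps_mul_var i s a :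
  (ps_monom k U_(i) * s) a = if a i == 0%N then 0 else s (a - U_(i))%MM.
Proof.
have [ai|ai] := eqVneq; last by rewrite -{1}(mnm_subUK ai) ps_mul_monom.
apply: contrapT => /ps_mul_coef_neq0[c [e [aE ci _]]].
move: ci; rewrite ps_monomE; have [cE|] := eqVneq; last by [].
by move: ai; rewrite aE cE mnmDE mnm1E eqxx.
Qed.

(* [s] is the sum of the [alpha_i * s_i], where [s_i] collects the monomials
   of [s] whose first variable is [alpha_i]. *)
Lemma ps_max_decomp s : ps_max s -> exists u : 'I_n -> S,
  s = \sum_i ps_monom k U_(i) * u i /\
  forall i b, u i b = s (b + U_(i))%MM \/ u i b = 0.
Proof.
move=> s0; pose first a (i : 'I_n) := [forall j : 'I_n, (j < i)%N ==> (a j == 0%N)].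
exists (fun i b => if first b i then s (b + U_(i))%MM else 0); split; last first.
  by move=> i b; case: ifP; [left | right].
apply/funext => a; rewrite ps_sumE.
have [->|a0] := eqVneq a 0%MM.
  rewrite s0 big1 // => i _; rewrite ps_mul_coef0 ps_monomE.
  by rewrite eq_sym mnm1_eq0 mul0r.
have /existsP[i0 ai0] : [exists i, a i != 0%N].
  apply: contraR a0 => /existsPn a0; apply/eqP/mnmP => i.
  by move/negPn/eqP: (a0 i) => ->; rewrite mnm0E.
(* Here [i] is the first variable dividing the monomial [a]; by [firstE] below, the [i]-th summand
   is the only one that contributes to the coefficient at [a]. *)
have [i ai imin] := @arg_minnP _ i0 (fun i => a i != 0%N) val ai0.
have firstE j : first (a - U_(j))%MM j && (a j != 0%N) = (j == i).
  apply/andP/eqP => [[/forallP fj aj]|->]; last first.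
    split=> //; apply/forallP => l; apply/implyP => li.
    rewrite mnmBE; apply: contraTT li => al; rewrite -leqNgt; apply: imin.
    by apply: contraNneq al => ->.
  apply/eqP; rewrite eqE /= eqn_leq (imin j aj) andbT leqNgt.
  apply/negP => ij; have := implyP (fj i) ij.
  by rewrite mnmBE mnm1E -val_eqE (gtn_eqF ij) /= subn0 (negbTE ai).
have term j : (ps_monom k U_(j) *
    (fun b => if first b j then s (b + U_(j))%MM else 0)) a = if j == i then s a else 0.
  rewrite ps_mul_var -firstE; have [aj|aj] := eqVneq (a j); first by rewrite andbF.
  by rewrite andbT addmC mnm_subUK.
by rewrite (bigD1 i) //= term eqxx big1 ?addr0 // => j ji; rewrite term (negbTE ji).
Qed.

(** For the converse of [ps_maxX_low], split off one variable at a time: each cofactor given by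
    [ps_max_decomp] vanishes below an order that is one smaller, so induction on [N] applies. *)
Lemma ps_maxXP N s : ps_maxX N s <-> forall a, (mdeg a < N)%N -> s a = 0.
Proof.
split=> [|s0]; first exact: ps_maxX_low.
elim: N s s0 => [|N IH] s s0.
  exists 1%N, (fun _ => s), (fun _ _ => 0); split; first by move=> _ [].
  by rewrite big_ord1 big_ord0 mulr1.
have [|u [sE us]] := @ps_max_decomp s; first by apply: (s0 0%MM); rewrite mdeg0.
rewrite sE; elim/big_ind: _ => [||i _]; [exact: ps_maxX0 | exact: ps_maxX_add |].
apply: (ps_maxXS (ps_max_var i)).
apply: IH => b bN; case: (us i b) => -> //; apply: s0.
by rewrite mdegD mdeg1 addn1.
Qed.

(** Reduces questions about maps that respect powers of the maximal ideal to finite combinations of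
    monomials. *)
Lemma ps_maxX_sub_trunc N s :
  ps_maxX N (s - \sum_(a : 'X_{1..n < N}) s a *: ps_monom k a).
Proof.
apply/ps_maxXP => b bN; rewrite -[LHS]/(s b - (\sum_(a : 'X_{1..n < N}) _) b) ps_sumE.
rewrite (bigD1 (BMultinom bN)) //= ps_scaleE ps_monomE eqxx mulr1 big1 ?addr0 ?subrr //.
move=> c cb; rewrite ps_scaleE ps_monomE; case: eqP => [bc|]; last by rewrite mulr0.
by case/eqP: cb; apply/val_inj.
Qed.

(** * Partial derivatives and the derivations in [aut] *)

Lemma ps_deriv_is_linear i : linear (@ps_deriv k n i : S -> S).
Proof.
by move=> c s t; apply/funext => a; rewrite /ps_deriv !ps_addE !ps_scaleE mulrnDl mulrnAr.
Qed.
HB.instance Definition _ i :=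
  GRing.isLinear.Build k S S *:%R (@ps_deriv k n i) (ps_deriv_is_linear i).

(** Each coefficient depends on finitely many coefficients of [s] and [t], so the rule is inherited
    from polynomials by truncation. *)
Lemma ps_derivM i s t : ps_deriv i (s * t) = ps_deriv i s * t + s * ps_deriv i t.
Proof.
(* Differentiation reads coefficients one degree higher, so the truncations must keep degree
   [mdeg a + 1]. *)
apply/funext => a; pose N := (mdeg a).+2; pose p := ps_trunc N s; pose q := ps_trunc N t.
have pE b : (mdeg b < N)%N -> s b = p@_b by move=> bN; rewrite ps_truncE.
have qE b : (mdeg b < N)%N -> t b = q@_b by move=> bN; rewrite ps_truncE.
have dE (u : S) (r : {mpoly k[n]}) : (forall b, (mdeg b < N)%N -> u b = r@_b) ->
    forall b, (mdeg b < N.-1)%N -> ps_deriv i u b = (r^`M(i))@_b.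
  by move=> uE b bN; rewrite mcoeff_deriv /ps_deriv uE // mdegD mdeg1 addn1.
have wE (u : S) (r : {mpoly k[n]}) : (forall b, (mdeg b < N)%N -> u b = r@_b) ->
    forall b, (mdeg b < N.-1)%N -> u b = r@_b.
  by move=> uE b bN; apply: uE; rewrite ltnW.
have aN : (mdeg a < N.-1)%N by [].
rewrite ps_addE [X in _ = X + _](ps_mul_trunc aN (dE _ _ pE) (wE _ _ qE)).
rewrite [X in _ = _ + X](ps_mul_trunc aN (wE _ _ pE) (dE _ _ qE)).
rewrite -mcoeffD -mderivM mcoeff_deriv /ps_deriv; congr (_ *+ _).
by apply: (@ps_mul_trunc _ _ N) => //; rewrite mdegD mdeg1 addn1.
Qed.

Lemma ps_deriv_var i j : ps_deriv i (ps_monom k U_(j)) = (i == j)%:R :> S.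
Proof.
have [<-|ij] := eqVneq i j; apply/funext => a; rewrite /ps_deriv ps_monomE.
  rewrite -{2}[U_(i)%MM]add0m eqm_add2r.
  rewrite -[RHS]/(ps_monom k 0%MM a) ps_monomE.
  by case: eqVneq => [->|]; rewrite ?mnm0E ?mulr1n ?mul0rn.
rewrite -[RHS]/(0 : k); case: eqVneq => [/mnmP/(_ i)|]; last by rewrite mul0rn.
by rewrite mnmDE !mnm1E eqxx eq_sym (negbTE ij) addn1.
Qed.

Definition derivation (v : 'I_n -> S) (s : S) : S := \sum_i v i * ps_deriv i s.

Lemma derivation_is_linear v : linear (derivation v).
Proof.
move=> c s t; rewrite /derivation scaler_sumr -big_split /=.
by apply: eq_bigr => i _; rewrite linearP mulrDr scalerAr.
Qed.
HB.instance Definition _ v :=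
  GRing.isLinear.Build k S S *:%R (derivation v) (derivation_is_linear v).

Lemma derivation_aut v : (forall i, ps_max (v i)) -> aut (derivation v).
Proof.
move=> mv; split=> [s t|s _].
  rewrite /= /derivation mulr_suml mulr_sumr -big_split; apply: eq_bigr => i _ /=.
  by rewrite ps_derivM mulrDr mulrA [v i * (s * _)]mulrCA.
rewrite /ps_max /= /derivation ps_sumE big1 // => i _.
by rewrite ps_mul_coef0 mv mul0r.
Qed.

(* Both sides are derivations that agree on the variables, hence on monomials;
   both preserve the powers of the maximal ideal, so they agree on series. *)
Lemma autE (D : {linear S -> S}) : aut D ->
  D =1 derivation (fun i => D (ps_monom k U_(i))).
Proof.
move=> aD; set v := fun i => _.
have mv i : ps_max (v i) by apply: aD.2; exact: ps_max_var.
have aE := derivation_aut mv; set E : {linear S -> S} := derivation v.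
rewrite -/(E : S -> S).
(* The Leibniz rule on [1 * 1] gives [F 1 = F 1 + F 1]. *)
have one0 (F : {linear S -> S}) : aut F -> F 1 = 0.
  move=> [FM _]; have := FM 1 1; rewrite mul1r mulr1 => /(congr1 (fun x => x - F 1)).
  by rewrite mul1r subrr addrK => <-.
have monomE N a : mdeg a = N -> D (ps_monom k a) = E (ps_monom k a).
  elim: N a => [|N IH] a aN.
    by move/eqP: aN; rewrite mdeg_eq0 => /eqP ->; rewrite !(one0 _ _).
  have /existsP[i ai] : [exists i, a i != 0%N].
    apply: contra_eqT aN => /existsPn a0; rewrite mdegE big1 // => i _.
    by apply/eqP; move/negPn: (a0 i).
  have aE' := esym (mnm_subUK ai).
  rewrite aE' -ps_monomM aD.1 aE.1 (IH (a - U_(i))%MM); last first.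
    by apply/eqP; rewrite -eqSS -aN [in X in _ == X]aE' mdegD mdeg1.
  congr (_ * _ + _); rewrite /= /derivation (bigD1 i) //= ps_deriv_var eqxx mulr1.
  by rewrite big1 ?addr0 // => j ji; rewrite ps_deriv_var (negbTE ji) mulr0.
(* With this [N], an element of the [N]-th power of the maximal ideal has zero coefficient at [a],
   so [s] may be replaced by its truncation [p]. *)
move=> s; apply/funext => a; pose N := (mdeg a).+1.
pose p : S := \sum_(b : 'X_{1..n < N}) s b *: ps_monom k b.
have spN : ps_maxX N (s - p) := ps_maxX_sub_trunc N s.
have FN (F : {linear S -> S}) : aut F -> F s a = F p a.
  move=> aF; apply/eqP; rewrite -subr_eq0; apply/eqP.
  have := (ps_maxXP _ _).1 (aut_maxX aF spN) a (ltnSn _).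
  by rewrite linearB.
rewrite (FN D aD) (FN E aE) /p !linear_sum !ps_sumE.
by apply: eq_bigr => b _; rewrite !linearZ (monomE _ _ erefl).
Qed.

End Series.

(** * The pairing with [P] and multiplication by [x_i] *)

Section Pairing.
Variables (k : fieldType) (n : nat).
Local Notation S := (pseries k n).
Implicit Types (s t : S) (f g : dpring k n) (a : 'X_{1..n}).

Lemma pairing_ext f g : (forall s, pairing s f = pairing s g) -> f = g.
Proof. by move=> fg; apply/val_inj/funext. Qed.

Lemma pairingP c s t f : pairing (c *: s + t) f = c * pairing s f + pairing t f.
Proof. by case: f => f /[dup] /asboolP[fl _] fP; exact: fl. Qed.

Lemma pairingDl s t f : pairing (s + t) f = pairing s f + pairing t f.
Proof. by rewrite -[s]scale1r pairingP scale1r mul1r. Qed.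

Lemma pairing0l f : pairing 0 f = 0.
Proof. by apply: (@addrI _ (pairing 0 f)); rewrite -pairingDl !addr0. Qed.

Lemma pairingZl c s f : pairing (c *: s) f = c * pairing s f.
Proof. by rewrite -[c *: s]addr0 pairingP pairing0l addr0. Qed.

Lemma pairingBl s t f : pairing (s - t) f = pairing s f - pairing t f.
Proof. by rewrite pairingDl -scaleN1r pairingZl mulN1r. Qed.

Lemma pairing_suml I (r : seq I) (P : pred I) (F : I -> S) f :
  pairing (\sum_(i <- r | P i) F i) f = \sum_(i <- r | P i) pairing (F i) f.
Proof. by elim/big_rec2: _ => [|i x y _ <-]; [exact: pairing0l | exact: pairingDl]. Qed.

Lemma pairing0r s : pairing s 0 = 0. Proof. by []. Qed.

Lemma pairingDr s f g : pairing s (f + g) = pairing s f + pairing s g.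
Proof. by []. Qed.

Lemma pairingZr s c f : pairing s (c *: f) = c * pairing s f.
Proof. by []. Qed.

Lemma pairing_sumr s I (r : seq I) (F : I -> dpring k n) :
  pairing s (\sum_(i <- r) F i) = \sum_(i <- r) pairing s (F i).
Proof. by elim/big_rec2: _ => // i x y _ <-. Qed.

Lemma pairing_contr s t f : pairing s (contr t f) = pairing (s * t) f.
Proof. by []. Qed.

Lemma pairing_dual_act (L : {linear S -> S}) (gL : aut_add_S L) s f :
  pairing s (dual_act gL f) = pairing (L s) f.
Proof. by []. Qed.

Lemma pairing_dpX s a : pairing s (dpX a) = s a.
Proof. by []. Qed.

(** A functional killing the [N]-th power of the maximal ideal sees only the truncation of [s] below
    degree [N], which turns the pairing into a finite sum over coefficients. *)
Lemma pairing_bound f : exists N, (forall a, (N <= mdeg a)%N -> dpcoef f a = 0) /\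
  forall s, pairing s f = \sum_(a : 'X_{1..n < N}) s a * dpcoef f a.
Proof.
have [N fN] : exists N, forall s, ps_maxX N s -> pairing s f = 0.
  by case: f => f /[dup] /asboolP[_ [N fN]] fP; exists N.
exists N; split=> [a aN|s].
  by apply/fN/ps_maxXP => b bN; rewrite ps_monomE; case: eqP bN => // ->; rewrite ltnNge aN.
pose p : S := \sum_(b : 'X_{1..n < N}) s b *: ps_monom k b.
have sp : pairing (s - p) f = 0 := fN _ (ps_maxX_sub_trunc N s).
move/eqP: sp; rewrite pairingBl subr_eq0 => /eqP ->.
by rewrite pairing_suml; apply: eq_bigr => b _; rewrite pairingZl.
Qed.

Lemma pairing_eq0 s f : (forall a, s a * dpcoef f a = 0) -> pairing s f = 0.
Proof. by have [N [_ ->]] := pairing_bound f => sf; rewrite big1. Qed.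

Lemma dpcoef_ext f g : dpcoef f =1 dpcoef g -> f = g.
Proof.
move=> fg; apply/eqP; rewrite -subr_eq0; apply/eqP/pairing_ext => s.
apply: pairing_eq0 => a.
by rewrite -[dpcoef _ _]/(dpcoef f a - dpcoef g a) fg subrr mulr0.
Qed.

Lemma dpmul_var i g : exists N, (forall a, (N <= mdeg a)%N -> dpcoef g a = 0) /\
  dpmul (dpX U_(i)%MM) g =
    \sum_(a : 'X_{1..n < N}) (dpcoef g a * (a i).+1%:R) *: dpX (U_(i) + a)%MM.
Proof.
have [N [gN _]] := pairing_bound g; exists N; split=> //.
(* The first factor has its only nonzero coefficient at [U_(i)] and [g] has none from degree [N] on,
   so this list contains the support. *)
rewrite /dpmul (fsbigE [seq (U_(i)%MM, val a) | a : 'X_{1..n < N}]) //=.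
- rewrite big_map big_enum_cond /=; apply: eq_big => [a|a _]; first exact: in_setT.
  rewrite ps_monomE eqxx mul1r; congr ((_ * _%:R) *: _).
  (* The binomial is ['C(1 + a i, 1)] at the index [i] and ['C(a j, 0)], that is 1, at any other
     [j]. *)
  rewrite (bigD1 i) //= big1 => [|j ji]; last first.
    by rewrite mnm1E eq_sym (negbTE ji) add0n bin0.
  by rewrite mnm1E eqxx add1n bin1 muln1.
- by rewrite map_inj_uniq ?enum_uniq // => a b [] /val_inj.
move=> [c a] _ /= canot; rewrite ps_monomE; have [cE|] := eqVneq; last first.
  by rewrite !mul0r scale0r.
rewrite gN ?mulr0 ?mul0r ?scale0r // leqNgt; apply: contra canot => aN.
by apply/mapP; exists (BMultinom aN); rewrite ?mem_enum // cE.
Qed.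

(** The factor [a i + 1] from the divided power product is the one that differentiation puts in
    front of the coefficient at [a + U_(i)]. *)
Lemma pairing_mul_var s i g :
  pairing s (dpmul (dpX U_(i)%MM) g) = pairing (ps_deriv i s) g.
Proof.
have [N [gN ->]] := dpmul_var i g; rewrite pairing_sumr.
have [M [gM ->]] := pairing_bound g.
pose F (a : 'X_{1..n}) := ps_deriv i s a * dpcoef g a.
(* The two sides come with bounds [N] and [M] that may differ; both sums are compared with the sum
   over all exponents. *)
have FE K : (forall a, (K <= mdeg a)%N -> dpcoef g a = 0) ->
    \sum_(a : 'X_{1..n < K}) F a = \sum_(a \in [set: 'X_{1..n}]) F a.
  move=> gK; rewrite (fsbigE [seq val a | a : 'X_{1..n < K}]) //=.
  - by rewrite big_map big_enum_cond /=; apply: eq_bigl => a; rewrite in_setT.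
  - by rewrite map_inj_uniq ?enum_uniq //; exact: val_inj.
  move=> a _ anot; rewrite /F gK ?mulr0 // leqNgt; apply: contra anot => aK.
  by apply/mapP; exists (BMultinom aK); rewrite ?mem_enum.
rewrite [RHS](FE M gM) -(FE N gN); apply: eq_bigr => a _.
rewrite pairingZr pairing_dpX /F /ps_deriv addmC.
by rewrite [LHS]mulrC [X in _ * X = _]mulrC mulrA mulr_natr.
Qed.

Lemma dpcoef_contr s f a : dpcoef (contr s f) a = pairing (ps_monom k a * s) f.
Proof. by []. Qed.

Lemma contr_eq0 s f : contr s f = 0 <-> forall t, pairing (t * s) f = 0.
Proof.
split=> [sf t|sf]; first by rewrite -pairing_contr sf.
by apply: pairing_ext => t; rewrite pairing_contr sf.
Qed.

(** A functional supported in degree 0 is a multiple of the evaluation at the constant term. *)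
Lemma pairing_coef0 s g :
  (forall a, a != 0%MM -> dpcoef g a = 0) -> pairing s g = s 0%MM * dpcoef g 0%MM.
Proof.
move=> g0; apply/eqP; rewrite -subr_eq0 -pairingZl -pairingBl; apply/eqP/pairing_eq0 => a.
have [->|a0] := eqVneq a 0%MM; last by rewrite g0 ?mulr0.
rewrite -[X in X * _]/(s 0%MM - s 0%MM * ps_monom k 0%MM 0%MM).
by rewrite ps_monomE eqxx mulr1 subrr mul0r.
Qed.

Lemma dpdeg_le0 g : (dpdeg g <= 0)%R <-> forall a, a != 0%MM -> dpcoef g a = 0.
Proof.
rewrite /dpdeg; case: eqP => [->|_]; first by split=> // _ a _; exact: pairing0r.
rewrite fsbig_finite; last exact: dpcoef_finite.
split=> [le0 a a0|g0].
  apply: contrapT => /eqP ga; case/negP: a0; rewrite -mdeg_eq0 -leqn0.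
  apply: leq_trans (le0 : (_ <= 0)%N).
  apply: leq_bigmax_seq => //; rewrite in_fset_set ?inE //; exact: dpcoef_finite.
rewrite big1_seq // => a /andP[_]; rewrite in_fset_set ?inE //; last exact: dpcoef_finite.
by move=> /= ga; apply/eqP; rewrite mdeg_eq0; apply: contraNT ga => a0; rewrite g0.
Qed.
End Pairing.

(** * The orbits under [aut] and [g], and the orthogonal *)

Section Orbits.
Variables (k : fieldType) (n : nat).
Local Notation S := (pseries k n).
Implicit Types (s t : S) (v : 'I_n -> S) (f h : dpring k n) (a : 'X_{1..n}).

Definition first_order_op v t (s : S) : S := derivation v s + t * s.

Lemma first_order_op_is_linear v t : linear (first_order_op v t).
Proof.
move=> c r s; rewrite /first_order_op linearP mulrDr scalerDr addrACA.
by rewrite -scalerAr.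
Qed.
HB.instance Definition _ v t :=
  GRing.isLinear.Build k S S *:%R (first_order_op v t) (first_order_op_is_linear v t).

Lemma first_order_op_aut_add_S v t :
  (forall i, ps_max (v i)) -> aut_add_S (first_order_op v t).
Proof. by move=> mv; exists (derivation v); split; [exact: derivation_aut | exists t]. Qed.

(** Replaces the quantifier over linear maps by one over coefficient tuples, using [autE]. *)
Lemma aut_orbitP f h : aut_orbit f h <->
  exists v, (forall i, ps_max (v i)) /\ forall s, pairing s h = pairing (derivation v s) f.
Proof.
split=> [[D [aD ->]]|[v [mv hE]]].
  exists (fun i => D (ps_monom k U_(i))); split=> [i|s]; last first.
    by rewrite pairing_dual_act (autE aD).
  by apply: aD.2; exact: ps_max_var.
by exists (derivation v), (derivation_aut mv); exact: pairing_ext.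
Qed.

Lemma g_orbitP f h : g_orbit f h <->
  exists v t, (forall i, ps_max (v i)) /\
    forall s, pairing s h = pairing (derivation v s + t * s) f.
Proof.
split=> [[L [gL ->]]|[v [t [mv hE]]]].
  have [D [aD [t LE]]] := gL.
  exists (fun i => D (ps_monom k U_(i))), t; split=> [i|s]; last first.
    by rewrite pairing_dual_act LE (autE aD).
  by apply: aD.2; exact: ps_max_var.
exists (first_order_op v t), (first_order_op_aut_add_S t mv).
exact: pairing_ext.
Qed.

Lemma pairing_derivation v s f :
  pairing (derivation v s) f = \sum_i pairing (ps_deriv i s) (contr (v i) f).
Proof. by rewrite pairing_suml; apply: eq_bigr => i _; rewrite mulrC. Qed.

(** By adjointness, [x_i] times the contraction of [f] by [v_i] pairs with [s] as
    [v_i * ps_deriv i s] does with [f]. *)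
Lemma aut_orbitE f : aut_orbit f =
  lspan [set h | exists (i : 'I_n) (delta : S),
    ps_max delta /\ h = dpmul (dpX U_(i)%MM) (contr delta f)].
Proof.
apply/seteqP; split=> h.
  move=> /aut_orbitP[v [mv hE]].
  exists n, (fun _ => 1), (fun i => dpmul (dpX U_(i)%MM) (contr (v i) f)); split.
    by move=> i; exists i, (v i).
  apply: pairing_ext => s; rewrite hE pairing_derivation pairing_sumr.
  by apply: eq_bigr => i _; rewrite scale1r pairing_mul_var.
move=> [r [c [w [wP ->]]]].
have [p pP] := choice (fun j => wP j); have [q qP] := choice (fun j => pP j).
(* Terms of the combination with the same variable are merged: [v_i] is the sum of the scaled
   [delta]s attached to [x_i], and stays in the maximal ideal. *)
apply/aut_orbitP; exists (fun i => \sum_(j | p j == i) c j *: q j); split=> [i|s].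
  elim/big_rec: _ => // j x _ x0; have [qj _] := qP j.
  by rewrite /ps_max /= ps_addE ps_scaleE qj x0 mulr0 addr0.
rewrite pairing_sumr (partition_big p xpredT) //= pairing_suml; apply: eq_bigr => i _.
rewrite mulr_suml pairing_suml; apply: eq_bigr => j /eqP <-.
rewrite -[LHS]/(c j * pairing s (w j)).
by rewrite -scalerAl pairingZl (qP j).2 pairing_mul_var pairing_contr [q j * _]mulrC.
Qed.

Lemma g_orbitE f : g_orbit f =
  subspace_add (ideal_act setT f)
    (subspace_sum (fun i => ideal_act ps_max (dpmul (dpX U_(i)%MM) f))).
Proof.
(* Contracting after multiplying by [x_i] differentiates the product of [s] and [v_i]; the extra
   Leibniz term is multiplication by the divergence of [v]. *)
have var_contr v s : \sum_i pairing s (contr (v i) (dpmul (dpX U_(i)%MM) f)) =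
    pairing (derivation v s + (\sum_i ps_deriv i (v i)) * s) f.
  rewrite pairingDl pairing_derivation mulr_suml pairing_suml -big_split.
  apply: eq_bigr => i _; rewrite pairing_contr pairing_mul_var ps_derivM pairingDl.
  by rewrite [s * _]mulrC.
apply/seteqP; split=> h.
  move=> /g_orbitP[v [t [mv hE]]].
  (* The divergence is an arbitrary multiplication operator, so it is absorbed into the summand
     [S f]; the reverse inclusion adds it back. *)
  pose u := t - \sum_i ps_deriv i (v i).
  exists (contr u f); first by exists u.
  exists (\sum_i contr (v i) (dpmul (dpX U_(i)%MM) f)).
    by exists (fun i => contr (v i) (dpmul (dpX U_(i)%MM) f)); split=> // i; exists (v i).
  apply: pairing_ext => s; rewrite hE pairingDr pairing_sumr var_contr pairing_contr.
  by rewrite -pairingDl [s * _]mulrC addrCA -mulrDl subrK.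
move=> [_ [t _ <-] [_ [w [wP ->]] <-]].
have wE i : exists u, ps_max u /\ contr u (dpmul (dpX U_(i)%MM) f) = w i.
  by have [u mu <-] := wP i; exists u.
have [v vP] := choice wE.
apply/g_orbitP; exists v, (t + \sum_i ps_deriv i (v i)); split=> [i|s].
  by have [] := vP i.
rewrite pairingDr pairing_sumr (eq_bigr _ (fun i _ => congr1 (pairing s) (esym (vP i).2))).
by rewrite var_contr pairing_contr -pairingDl mulrDl addrCA [s * t]mulrC.
Qed.

Lemma perp_g_orbit f s : perp (g_orbit f) s <->
  contr s f = 0 /\
  forall i a, a != 0%MM -> dpcoef (contr (ps_deriv i s) f) a = 0.
Proof.
split=> [sP|[sf ds] h /g_orbitP[v [t [mv ->]]]]; last first.
  rewrite pairingDl pairing_derivation (contr_eq0 s f).1 // addr0 big1 // => i _.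
  (* Commutativity moves the contraction from [v i] to [ps_deriv i s]; by [ds] the result reads only
     the constant term of [v i], which is 0. *)
  rewrite pairing_contr mulrC -pairing_contr pairing_coef0; last exact: ds.
  by rewrite mv mul0r.
have sP' : forall v t, (forall i, ps_max (v i)) ->
    pairing (derivation v s + t * s) f = 0.
  move=> v t mv; have gL := first_order_op_aut_add_S t mv.
  by apply: (sP (dual_act gL f)); exists (first_order_op v t), gL.
split=> [|i a a0].
  apply/contr_eq0 => t; have := sP' (fun _ => 0) t (fun _ => erefl).
  by rewrite /derivation big1 ?add0r // => i _; rewrite mul0r.
(* A tuple supported at [i] with a nonconstant monomial as entry isolates the coefficient at [a]. *)
have := sP' (fun j => if j == i then ps_monom k a else 0) 0.
rewrite mul0r addr0 /derivation (bigD1 i) //= eqxx big1 ?addr0; last first.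
  by move=> j /negbTE ->; rewrite mul0r.
by apply=> j; case: eqP => // _; exact: ps_max_monom.
Qed.

(** * Homogeneous [f] *)

Lemma ps_deriv_homog_comp i j s : ps_deriv i (ps_homog_comp j s) =
  if j is j'.+1 then ps_homog_comp j' (ps_deriv i s) else 0.
Proof.
apply/funext => a; rewrite /ps_deriv /ps_homog_comp mdegD mdeg1 addn1.
by case: j => [|j]; rewrite ?mul0rn // eqSS; case: ifP; rewrite ?mul0rn.
Qed.

Lemma dpcoef_contr_homog_comp d f s j a : dphomog d f ->
  dpcoef (contr (ps_homog_comp j s) f) a =
    if (mdeg a + j == d)%N then dpcoef (contr s f) a else 0.
Proof.
(* Only the degree [d] part of a series pairs nontrivially with [f]. *)
move=> fd; rewrite !dpcoef_contr; case: eqP => [ajd|ajd].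
  apply/eqP; rewrite -subr_eq0 -pairingBl; apply/eqP/pairing_eq0 => b.
  have [bd|/fd ->] := eqVneq (mdeg b) d; last by rewrite mulr0.
  rewrite -mulrBr [X in X * _ = _](_ : _ = 0) ?mul0r //.
  apply: contrapT => /ps_mul_coef_neq0[c [e [bE]]]; rewrite ps_monomE.
  have [ca _|] := eqVneq c a; last by [].
  rewrite -[X in X <> _]/(ps_homog_comp j s e - s e) /ps_homog_comp ifT ?subrr //.
  by rewrite -(eqn_add2l (mdeg a)) ajd -bd bE ca mdegD.
apply: pairing_eq0 => b; have [bd|/fd ->] := eqVneq (mdeg b) d; last by rewrite mulr0.
rewrite [X in X * _ = _](_ : _ = 0) ?mul0r //.
apply: contrapT => /ps_mul_coef_neq0[c [e [bE]]]; rewrite ps_monomE.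
have [ca _|] := eqVneq c a; last by [].
rewrite /ps_homog_comp; case: eqP => // ej.
by case: ajd; rewrite -bd bE ca mdegD ej.
Qed.

(** The conditions of [perp_g_orbit] are vanishing of coefficients, and passing to a component of
    [s] either keeps such a coefficient or replaces it by 0. *)
Lemma perp_homog_comp d f s j : dphomog d f ->
  perp (g_orbit f) s -> perp (g_orbit f) (ps_homog_comp j s).
Proof.
move=> fd /perp_g_orbit[sf ds]; apply/perp_g_orbit; split=> [|i a a0].
  apply: dpcoef_ext => a; rewrite (dpcoef_contr_homog_comp _ _ _ fd).
  by rewrite sf; case: ifP.
rewrite ps_deriv_homog_comp; case: j => [|j].
  by rewrite dpcoef_contr mulr0 pairing0l.
by rewrite (dpcoef_contr_homog_comp _ _ _ fd) ds // if_same.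
Qed.

Lemma perp_poly_le d f : dphomog d f ->
  perp (g_orbit f) `&` ps_poly_le d =
    [set s | [/\ ps_poly_le d s, contr s f = 0 & forall i, contr (ps_deriv i s) f = 0]].
Proof.
move=> fd; apply/seteqP; split=> s.
  move=> [/perp_g_orbit[sf ds] sd]; split=> // i; apply: dpcoef_ext => a.
  have [->|a0] := eqVneq a 0%MM; last by rewrite ds.
  rewrite dpcoef_contr -/(1 : S) mul1r; apply: pairing_eq0 => b.
  have [bd|/fd ->] := eqVneq (mdeg b) d; last by rewrite mulr0.
  (* For [b] of degree [d], the derivative reads [s] in degree [d + 1], just above the bound on
     [s]. *)
  by rewrite /ps_deriv sd ?mul0rn ?mul0r // mdegD mdeg1 addn1 bd.
move=> [sd sf ds]; split=> //; apply/perp_g_orbit; split=> // i a _.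
by rewrite ds; exact: pairing0r.
Qed.

End Orbits.

Theorem proposition2p18 (k : closedFieldType) (n : nat) (f : dpring k n) :
  [/\ aut_orbit f =
        lspan [set h | exists (i : 'I_n) (delta : pseries k n),
          ps_max delta /\ h = dpmul (dpX U_(i)%MM) (contr delta f)],
      g_orbit f =
        subspace_add (ideal_act setT f)
          (subspace_sum (fun i => ideal_act ps_max (dpmul (dpX U_(i)%MM) f))),
      perp (g_orbit f) =
        [set sigma | contr sigma f = 0 /\
           forall i, (dpdeg (contr (ps_deriv i sigma) f) <= 0)%R]
    & forall d : nat, dphomog d f ->
        (forall sigma, perp (g_orbit f) sigma ->
           forall j, perp (g_orbit f) (ps_homog_comp j sigma)) /\
        perp (g_orbit f) `&` ps_poly_le d =
          [set sigma | [/\ ps_poly_le d sigma, contr sigma f = 0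
             & forall i, contr (ps_deriv i sigma) f = 0]]].
Proof.
split; [exact: aut_orbitE | exact: g_orbitE | |].
  apply/seteqP; split=> s /=.
    by move=> /perp_g_orbit[sf ds]; split=> // i; apply/dpdeg_le0; exact: ds.
  by move=> [sf ds]; apply/perp_g_orbit; split=> // i; apply/dpdeg_le0.
move=> d fd; split; last exact: perp_poly_le.
by move=> s sP j; exact: perp_homog_comp fd sP.
Qed.
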